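(* Let $\mathsf{X}$ be a finite connected graph with no tails, with ramified vertices at least one of which is totally ramified, and suppose $\mathsf{X}$ has a segment decomposition with segments $\mathsf{S}^1,\dots,\mathsf{S}^k$ (2-segments $\mathsf{S}^1,\dots,\mathsf{S}^{k'}$ and 1-segments $\mathsf{S}^{k'+1},\dots,\mathsf{S}^k$), $\mathsf{S}^i$ having $t_i$ ramified vertices. Let $\mathsf{X}_n$ be the $n$-th layer of the corresponding $\mathbb{Z}_p$-tower with trivial voltage assignment. Let $n_0$ be large enough that the number of vertices of $\mathsf{X}_n$ lying over ramified vertices of $\mathsf{X}$ is constant for $n\ge n_0$, and denote this number by $l$. Then for $n\ge n_0$, \[\kappa(\mathsf{X}_n)=\kappa(\mathsf{X}_{n_0})\,p^{(n-n_0)(l-1)}\prod_{i=1}^k F_{t_i}(\mathsf{S}^i)^{p^n-p^{n_0}}.\]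
   Context: Graphs are finite and undirected, possibly with multiple edges and loops; $\kappa$ = number of spanning trees. Tails, admissible paths, segment decompositions: a tail is an unramified vertex with exactly one neighbour joined by exactly one edge; an admissible path between ramified $v,v'$ has all intermediate vertices unramified. Admissible paths between distinct ramified vertices sharing an edge are grouped together; a decomposition requires each group to join one pair of ramified vertices, and groups give the 2-segments; the remaining edges lie on admissible closed paths at a single ramified vertex outside the 2-segments, grouped likewise into 1-segments; segments are edge-disjoint, share no unramified vertex and cover $\mathsf{X}$. $F_t(\mathsf{S})$ ($t\in\{1,2\}$) is the number of spanning forests of $\mathsf{S}$ with $t$ trees each containing exactly one ramified vertex. Tower: $\Gamma\cong\mathbb{Z}_p$, $\Gamma_n=\Gamma/\Gamma^{p^n}$, trivial voltage assignment; each vertex $v$ has a closed subgroup $I_v\subseteq\Gamma$, $v$ ramified iff $I_v\ne1$, totally ramified iff $I_v=\Gamma$. $\mathsf{X}_n$ has vertex set $\bigsqcup_v\{v\}\times\Gamma_n/\pi_n(I_v)$ and directed edges $\mathbf{E}(\mathsf{X})\times\Gamma_n$, $(e,g)$ joining $(o(e),g\pi_n(I_{o(e)}))$ to $(t(e),g\pi_n(I_{t(e)}))$; all $\mathsf{X}_n$ are connected. *)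

(* Defs.v *)
From Stdlib Require Import Relation_Operators.
From mathcomp Require Import all_boot.
Set Implicit Arguments.
Unset Strict Implicit.
Unset Printing Implicit Defensive.

(* Finite undirected multigraphs (loops and multiple edges allowed).   *)
(* A graph is given by a finite vertex type V, a finite edge type E    *)
(* and, for each edge, its two endpoints [ends e] (an arbitrary but    *)
(* fixed orientation, o(e) = (ends e).1, t(e) = (ends e).2).          *)
Section Graph.
Variables (V E : finType) (ends : E -> V * V).

Definition incident (e : E) (v : V) : bool := ((ends e).1 == v) || ((ends e).2 == v).

Definition adj (F : {set E}) : rel V :=
  fun x y => [exists e in F, (ends e == (x, y)) || (ends e == (y, x))].

Definition gconnected : bool := [forall x, forall y, connect (adj setT) x y].

(* F has no cycle: no edge of F lies on a cycle of F, i.e. the endpoints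
   of each edge of F are not joined in F minus that edge (loops are
   cycles). *)
Definition acyclic (F : {set E}) : bool :=
  [forall e in F, ~~ connect (adj (F :\ e)) (ends e).1 (ends e).2].

Definition spanning_tree (T : {set E}) : bool :=
  acyclic T && [forall x, forall y, connect (adj T) x y].

Definition kappa : nat := #|[set T : {set E} | spanning_tree T]|.

Definition vert_of (S : {set E}) : {set V} := [set v | [exists e in S, incident e v]].

Variable ram : pred V.

(* tail: unramified vertex with exactly one neighbour, joined by exactly
   one edge (so exactly one incident edge, which is not a loop) *)
Definition tail (v : V) : bool :=
  ~~ ram v && [exists e, [&& (ends e).1 != (ends e).2, incident e v &
                           [forall f, incident f v ==> (f == e)]]].

Definition good_forest (t : nat) (S F : {set E}) : bool :=
  [&& F \subset S, acyclic F,
      n_comp (adj F) (mem (vert_of S)) == t &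
      [forall x in vert_of S,
         #|[set r in vert_of S | ram r && connect (adj F) x r]| == 1]].

Definition Fnum (t : nat) (S : {set E}) : nat :=
  #|[set F : {set E} | good_forest t S F]|.

Definition nram_in (S : {set E}) : nat := #|[set v in vert_of S | ram v]|.

Definition dsrc (d : E * bool) : V := if d.2 then (ends d.1).2 else (ends d.1).1.
Definition dtgt (d : E * bool) : V := if d.2 then (ends d.1).1 else (ends d.1).2.

Definition admissible (u v : V) (w : seq (E * bool)) : bool :=
  match w with
  | [::] => false
  | d :: w' => [&& ram u, ram v, dsrc d == u,
                  path (fun a b => dtgt a == dsrc b) d w',
                  dtgt (last d w') == v &
                  all (fun a => ~~ ram (dtgt a)) (belast d w')]
  end.

Definition adm2 (w : seq (E * bool)) : Prop := exists u v, u != v /\ admissible u v w.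

Definition on_some (P : seq (E * bool) -> Prop) (e : E) : Prop :=
  exists w, P w /\ e \in map fst w.

(* two edges linked if some path of P contains both; groups = classes of
   the equivalence generated (paths sharing an edge are grouped) *)
Definition link (P : seq (E * bool) -> Prop) (e f : E) : Prop :=
  exists w, [/\ P w, e \in map fst w & f \in map fst w].

Definition same_group (P : seq (E * bool) -> Prop) : E -> E -> Prop :=
  clos_refl_trans E (link P).

(* Segment decomposition with segments S 0 .. S (k-1): the 2-segments are
   S i, i < k', the 1-segments are S i, k' <= i < k. *)
Definition segment_decomposition (k' k : nat) (S : 'I_k -> {set E}) : Prop :=
  let D2 := \bigcup_(i : 'I_k | i < k') S i in
  let adm1 := fun w => exists u, admissible u u w /\ all (fun d => d.1 \notin D2) w in
  k' <= k /\
  (forall w1 w2 u1 v1 u2 v2, admissible u1 v1 w1 -> u1 != v1 ->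
          admissible u2 v2 w2 -> u2 != v2 ->
          (exists e1 e2, [/\ e1 \in map fst w1, e2 \in map fst w2 & same_group adm2 e1 e2]) ->
          (u1 = u2 /\ v1 = v2) \/ (u1 = v2 /\ v1 = u2)) /\
  (forall i : 'I_k, i < k' ->
          exists e, on_some adm2 e /\ forall f, f \in S i <-> same_group adm2 e f) /\
  (forall e, on_some adm2 e -> exists i : 'I_k, i < k' /\ e \in S i) /\
  (forall e, e \notin D2 -> on_some adm1 e) /\
  (forall i : 'I_k, k' <= i ->
          exists e, on_some adm1 e /\ forall f, f \in S i <-> same_group adm1 e f) /\
  (forall e, on_some adm1 e -> exists i : 'I_k, k' <= i /\ e \in S i) /\
  (forall i j : 'I_k, i != j -> [disjoint S i & S j]) /\
  (forall (i j : 'I_k) v, i != j -> ~~ ram v ->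
             ~ (v \in vert_of (S i) /\ v \in vert_of (S j))) /\
  (forall e, exists i, e \in S i) /\
  (forall v, exists i, v \in vert_of (S i)).

End Graph.

(* The Z_p-tower with trivial voltage assignment.                      *)
(* A closed subgroup of Gamma = Z_p is either trivial (None) or        *)
(* p^m Z_p (Some m); I_v = Gamma iff Some 0.  Then                     *)
(* Gamma_n / pi_n(I_v) = Z/p^(lev v n) with lev = n (I_v = 1) or       *)
(* min(m,n) (I_v = p^m Z_p), and the quotient map sends g to g mod     *)
(* p^(lev v n).                                                        *)
Definition ramified {V : Type} (I : V -> option nat) (v : V) : bool := I v != None.
Definition totally_ramified {V : Type} (I : V -> option nat) (v : V) : Prop := I v = Some 0.

Definition lev {V : Type} (I : V -> option nat) (v : V) (n : nat) : nat :=
  match I v with None => n | Some m => minn m n end.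

Lemma lev_le {V : Type} (I : V -> option nat) v n : lev I v n <= n.
Proof. by rewrite /lev; case: (I v) => // m; rewrite geq_minr. Qed.

Lemma pexp_pos (p n k : nat) : k <= n -> 'I_(p ^ n) -> 0 < p ^ k.
Proof.
move=> hk g; have h : 0 < p ^ n by apply: leq_ltn_trans (leq0n g) (ltn_ord g).
rewrite expn_gt0 in h; rewrite expn_gt0.
case/orP: h => [h|/eqP n0]; first by apply/orP; left.
by move: hk; rewrite n0 leqn0 => /eqP ->; rewrite orbT.
Qed.

Definition proj_mod (p n k : nat) (hk : k <= n) (g : 'I_(p ^ n)) : 'I_(p ^ k) :=
  Ordinal (ltn_pmod g (pexp_pos hk g)).

Section Tower.
Variables (V E : finType) (ends : E -> V * V) (I : V -> option nat) (p n : nat).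

(* vertices of X_n: pairs (v, coset in Gamma_n / pi_n(I_v)) *)
Definition tvert : finType := {v : V & 'I_(p ^ lev I v n)}.
Definition tedge : finType := (E * 'I_(p ^ n))%type.

Definition tpt (v : V) (g : 'I_(p ^ n)) : tvert :=
  Tagged (fun v => 'I_(p ^ lev I v n)) (proj_mod (lev_le I v n) g).

Definition tends (x : tedge) : tvert * tvert :=
  (tpt (ends x.1).1 x.2, tpt (ends x.1).2 x.2).

Definition nram_layer : nat := #|[set x : tvert | ramified I (tag x)]|.

End Tower.

Arguments tends {V E} ends I p n x.
Arguments tpt {V} I p n v g.
Arguments nram_layer {V} I p n.

(* Main.v *)
From Stdlib Require Import Relation_Operators.
Require Import Defs.
From mathcomp Require Import all_boot.
Set Implicit Arguments.
Unset Strict Implicit.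
Unset Printing Implicit Defensive.

(** Cut [X_n] into the copies [(i, g)], [g] in [Gamma_n], of the segments.  The
   copies only meet in ramified vertices, and each has at most two of these, its
   terminals.  Hence a subgraph of [X_n] is a spanning tree iff every copy is
   spanned either by a tree or by a forest separating its terminals, and the
   copies of the first kind form a spanning tree of the graph [Y_n] whose
   vertices are the ramified vertices and whose edges are the copies.  This
   writes [kappa(X_n)] as a weighted count of the spanning trees of [Y_n].  For
   [n >= n0] the terminals of [(i, g)] depend only on [g] modulo [p^n0], so that
   [Y_n] is [Y_n0] with each edge replaced by [q = p^(n - n0)] parallel ones;
   each of the [l - 1] edges of a spanning tree of [Y_n0] can be lifted in [q]
   ways, and every bundle contributes [q - 1] additional factors [F_t]. *)

(** * Spanning trees of multigraphs *)

Lemma connect_ind_right (T : finType) (e : rel T) (x : T) (P : T -> Prop) :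
  P x -> (forall y z, connect e x y -> P y -> e y z -> P z) ->
  forall y, connect e x y -> P y.
Proof.
move=> Px step y /connectP[s]; elim/last_ind: s y => [|s z IHs] y /=.
  by move=> _ ->.
rewrite rcons_path last_rcons => /andP[es ez] ->.
by apply: step (IHs _ es erefl) ez; apply/connectP; exists s.
Qed.

Section GraphTheory.
Variables (V E : finType) (ends : E -> V * V).
Implicit Types (F G S : {set E}) (x y z u v : V).

Lemma adjP F x y :
  reflect (exists2 e, e \in F & ends e = (x, y) \/ ends e = (y, x))
          (adj ends F x y).
Proof.
apply: (iffP existsP) => [[e /andP[eF /orP[]/eqP]]|[e eF [] ee]].
- by exists e; [|left].
- by exists e; [|right].
- by exists e; rewrite eF ee eqxx.
- by exists e; rewrite eF ee eqxx orbT.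
Qed.

Lemma adj_sym F : symmetric (adj ends F).
Proof.
by move=> x y; apply/adjP/adjP => -[e eF [] ee]; exists e; auto.
Qed.

Lemma adj_connectC F x y : connect (adj ends F) x y = connect (adj ends F) y x.
Proof. exact: (sym_connect_sym (@adj_sym F)). Qed.

Lemma adj_edge F e : e \in F -> adj ends F (ends e).1 (ends e).2.
Proof. by move=> eF; apply/adjP; exists e; [|left; case: (ends e)]. Qed.

Lemma connect_edge F e : e \in F -> connect (adj ends F) (ends e).1 (ends e).2.
Proof. by move=> eF; apply: connect1; apply: adj_edge. Qed.

Lemma connect_adjS F G x y : F \subset G ->
  connect (adj ends F) x y -> connect (adj ends G) x y.
Proof.
move=> /subsetP sFG; apply: connect_sub => {}x {}y /adjP[e eF xy].
by apply: connect1; apply/adjP; exists e; first exact: sFG.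
Qed.

Lemma connect_adj0 x y : connect (adj ends set0) x y -> x = y.
Proof.
elim/connect_ind_right: y / => // y z _ _ /adjP[e].
by rewrite inE.
Qed.

Lemma acyclicS F G : F \subset G -> acyclic ends G -> acyclic ends F.
Proof.
move=> sFG /forall_inP acG; apply/forall_inP => e eF.
apply: contra (acG _ (subsetP sFG _ eF)).
by apply: connect_adjS; apply: setSD.
Qed.

(** A walk can be shortened until it crosses the new edge at most once, in one of its two
    directions. *)
Lemma connect_setU1 F e x y : connect (adj ends (e |: F)) x y ->
  [\/ connect (adj ends F) x y,
      connect (adj ends F) x (ends e).1 /\ connect (adj ends F) (ends e).2 y |
      connect (adj ends F) x (ends e).2 /\ connect (adj ends F) (ends e).1 y].
Proof.
elim/connect_ind_right: y /; first by constructor 1; exact: connect0.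
move=> y z _ IH /adjP[e' /setU1P[-> {e'}|e'F]] yz; last first.
  have cyz : connect (adj ends F) y z by apply: connect1; apply/adjP; exists e'.
  by case: IH => [xy|[xe ey]|[xe ey]];
    [constructor 1|constructor 2; split => //|constructor 3; split => //];
    apply: connect_trans cyz.
case: yz => ee; rewrite ee /= in IH *.
- case: IH => [xy|[xe ey]|[xe ey]].
  + by constructor 2; rewrite connect0.
  + by constructor 2; rewrite connect0.
  + by constructor 1.
- case: IH => [xy|[xe ey]|[xe ey]].
  + by constructor 3; rewrite connect0.
  + by constructor 1.
  + by constructor 3; rewrite connect0.
Qed.

(* In a minimal subset of [G1] joining [u] to [v], any edge would close a
   cycle with [G2]. *)
Lemma acyclic_disjoint_connect F G1 G2 u v : acyclic ends F ->
  G1 \subset F -> G2 \subset F -> [disjoint G1 & G2] ->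
  connect (adj ends G1) u v -> connect (adj ends G2) u v -> u = v.
Proof.
move=> /forall_inP acF; move: {2}#|G1| (leqnn #|G1|) => m.
elim: m G1 => [|m IHm] G1 cG1 s1 s2 d12 c1 c2.
  by move: cG1 c1; rewrite leqn0 cards_eq0 => /eqP-> /connect_adj0.
have [G10|[e eG1]] := set_0Vmem G1.
  by move: c1; rewrite G10 => /connect_adj0.
have s1' : G1 :\ e \subset F by apply: subset_trans s1; apply: subsetDl.
have [ce|nce] := boolP (connect (adj ends (G1 :\ e)) u v).
  apply: (IHm (G1 :\ e)) => //.
    by move: cG1; rewrite (cardsD1 e) eG1.
  by apply: disjointWl d12; apply: subsetDl.
have eF := subsetP s1 _ eG1.
have eG2 : e \notin G2 by rewrite (disjointFr d12).
have t1 x y : connect (adj ends (G1 :\ e)) x y -> connect (adj ends (F :\ e)) x y.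
  by apply: connect_adjS; apply: setSD.
have t2 : connect (adj ends (F :\ e)) u v.
  by apply: connect_adjS c2; rewrite subsetD1 s2.
move: c1; rewrite -{1}(setD1K eG1) => /connect_setU1[ce|[ue ev]|[ue ev]].
- by rewrite ce in nce.
- case/negP: (acF _ eF).
  rewrite adj_connectC in ue; rewrite adj_connectC in ev.
  exact: connect_trans (t1 _ _ ue) (connect_trans t2 (t1 _ _ ev)).
- case/negP: (acF _ eF); rewrite adj_connectC.
  rewrite adj_connectC in ue; rewrite adj_connectC in ev.
  exact: connect_trans (t1 _ _ ue) (connect_trans t2 (t1 _ _ ev)).
Qed.

Definition component F x : {set V} := [set y | connect (adj ends F) x y].

Lemma mem_component F x : x \in component F x.
Proof. by rewrite inE connect0. Qed.

Lemma component_eq F x y :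
  (component F x == component F y) = connect (adj ends F) x y.
Proof.
apply/eqP/idP => [exy|cxy]; first by have := mem_component F y; rewrite -exy inE.
apply/setP => z; rewrite !inE.
exact: (same_connect (sym_connect_sym (@adj_sym F)) cxy).
Qed.

Lemma component_setU1 F e x :
  component (e |: F) x =
    if connect (adj ends F) x (ends e).1 || connect (adj ends F) x (ends e).2
    then component F (ends e).1 :|: component F (ends e).2 else component F x.
Proof.
have s z t : connect (adj ends F) z t -> connect (adj ends (e |: F)) z t.
  by apply: connect_adjS; apply: subsetUr.
have ce : connect (adj ends (e |: F)) (ends e).1 (ends e).2.
  by apply: connect_edge; apply: setU11.
have ce' : connect (adj ends (e |: F)) (ends e).2 (ends e).1.
  by rewrite adj_connectC.
apply/setP => y; rewrite inE; case: ifPn => [xe|].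
  rewrite !inE; apply/idP/idP => [/connect_setU1[xy|[_ ->]|[_ ->]]|].
  - by case/orP: xe => xe; rewrite adj_connectC in xe;
      rewrite (connect_trans xe xy) ?orbT.
  - by rewrite orbT.
  - by [].
  by case/orP: xe => /s xe /orP[]/s ey; apply: connect_trans xe _ => //;
    apply: connect_trans ey.
rewrite negb_or !inE => /andP[/negbTE n1 /negbTE n2]; apply/idP/idP => [|/s//].
by move=> /connect_setU1[//||]; rewrite ?n1 ?n2; case.
Qed.

(** Induction on [#|F|]: the endpoints of an edge [e] of a forest lie in different components of
    [F :\ e]; restoring [e] merges these two and leaves the others unchanged. *)
Lemma card_components F : acyclic ends F ->
  #|[set component F x | x in setT]| + #|F| = #|V|.
Proof.
move: {2}#|F| (erefl #|F|) => m; elim: m F => [|m IHm] F cF acF.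
  move/eqP: cF; rewrite cards_eq0 => /eqP ->; rewrite cards0 addn0.
  rewrite card_imset ?cardsT // => x y /eqP; rewrite component_eq.
  exact: connect_adj0.
have /card_gt0P[e eF] : 0 < #|F| by rewrite cF.
pose G := F :\ e.
have nab : ~~ connect (adj ends G) (ends e).1 (ends e).2.
  by move/forall_inP: (acF) => /(_ e eF).
have cG : #|G| = m by apply/eqP; move/eqP: cF; rewrite (cardsD1 e) eF.
rewrite -(IHm G cG (acyclicS (subsetDl _ _) acF)) cF cG addnS -addSn.
congr (_ + _).
pose a := (ends e).1; pose b := (ends e).2.
(* [D] consists of the components of [G] that contain neither endpoint of [e]; they are shared by
   [F] and [G]. *)
pose N := [set x | ~~ (connect (adj ends G) x a || connect (adj ends G) x b)].
pose D := [set component G x | x in N].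
have eFG : F = e |: G by rewrite setD1K.
have comF : [set component F x | x in setT] =
            (component G a :|: component G b) |: D.
  apply/setP => K; rewrite in_setU1; apply/imsetP/orP => [[x _ ->]|[/eqP->|]].
  - rewrite eFG component_setU1; case: ifPn => [_|nx]; [by left|right].
    by apply: imset_f; rewrite inE.
  - by exists a => //; rewrite eFG component_setU1 -/a connect0.
  - case/imsetP=> x; rewrite inE => nx ->; exists x => //.
    by rewrite eFG component_setU1 (negbTE nx).
have comG : [set component G x | x in setT] =
            component G a |: (component G b |: D).
  apply/setP => K; rewrite !in_setU1; apply/imsetP/or3P => [[x _ ->]|].
  - have [nx|] := boolP (x \in N); first by constructor 3; apply: imset_f.
    by rewrite inE negbK -!component_eq => /orP[]; [constructor 1|constructor 2].
  - case=> [/eqP->|/eqP->|]; [by exists a|by exists b|].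
    by case/imsetP=> x _ ->; exists x.
have aD : a \notin cover D.
  apply/bigcupP => -[_ /imsetP[x xN ->]].
  by move: xN; rewrite !inE => /norP[/negbTE->].
have bD : b \notin cover D.
  apply/bigcupP => -[_ /imsetP[x xN ->]].
  by move: xN; rewrite !inE => /norP[_ /negbTE->].
have nD (K : {set V}) x : x \in K -> x \notin cover D -> K \notin D.
  by move=> xK; apply: contra => KD; apply/bigcupP; exists K.
rewrite comF comG !cardsU1 in_setU1 negb_or component_eq nab.
by rewrite (nD _ a _ aD) ?inE ?connect0 // (nD _ a _ aD) ?mem_component //
  (nD _ b _ bD) ?mem_component.
Qed.

Lemma spanning_treeP T :
  reflect (acyclic ends T /\ forall x y, connect (adj ends T) x y)
          (spanning_tree ends T).
Proof.
apply: (iffP andP) => [[acT /forallP cT]|[acT cT]]; split => //.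
  by move=> x; apply/forallP.
by apply/forallP => x; apply/forallP => y.
Qed.

Lemma card_spanning_tree (x0 : V) T : spanning_tree ends T -> #|T| = #|V| - 1.
Proof.
case/spanning_treeP=> acT cT; rewrite -(card_components acT).
suff -> : [set component T x | x in setT] = [set component T x0].
  by rewrite cards1 addKn.
apply/setP => K; rewrite inE; apply/imsetP/eqP => [[x _ ->]|->]; last by exists x0.
by apply/eqP; rewrite component_eq.
Qed.

End GraphTheory.

(** * Gluing along terminals *)

(* The flag [b] tells whether [F] joins the terminals [u] and [v] of [S], making
   it a tree, or separates them.  For [u = v] only [b = false] is possible. *)
Definition local_forest (V E : finType) (ends : E -> V * V) (S : {set E})
    (u v : V) (b : bool) (F : {set E}) : bool :=
  [&& F \subset S, acyclic ends F,
      [forall x in vert_of ends S,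
         connect (adj ends F) x u || connect (adj ends F) x v] &
      ((u != v) && connect (adj ends F) u v) == b].

Section Gluing.
Variables (V E W C : finType) (ends : E -> V * V) (endsY : C -> W * W).
Variables (io : W -> V) (seg : E -> C).

Definition seg_edges c : {set E} := [set e | seg e == c].

(** These are the edges that [T] selects in the glued graph. Pieces with a single terminal are
    excluded, as in the flag of [local_forest]: they would be loops. *)
Definition joined (T : {set E}) : {set C} :=
  [set c | (io (endsY c).1 != io (endsY c).2) &&
           connect (adj ends (T :&: seg_edges c)) (io (endsY c).1) (io (endsY c).2)].

Definition terminal c (w : W) : Prop := w = (endsY c).1 \/ w = (endsY c).2.

Hypothesis io_inj : injective io.
Hypothesis seg_meet : forall c c' v, c != c' -> v \in vert_of ends (seg_edges c) ->
  v \in vert_of ends (seg_edges c') -> exists w, v = io w.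
Hypothesis seg_terminal : forall c w, io w \in vert_of ends (seg_edges c) ->
  terminal c w.

Lemma edge_vert (F : {set E}) e x y : e \in F ->
  ends e = (x, y) \/ ends e = (y, x) ->
  x \in vert_of ends F /\ y \in vert_of ends F.
Proof.
move=> eF xy; split; rewrite inE; apply/existsP; exists e; rewrite eF /incident.
  by case: xy => ->; rewrite eqxx ?orbT.
by case: xy => ->; rewrite eqxx ?orbT.
Qed.

(** Distinct terminals [r] and [r'] of [c] are its two ends in some order, so that [c] itself is the
    edge joining them. *)
Lemma terminal_joined T c r r' : terminal c r -> terminal c r' ->
  connect (adj ends (T :&: seg_edges c)) (io r) (io r') ->
  connect (adj endsY (joined T)) r r'.
Proof.
have [-> //|nrr'] := eqVneq r r'.
move=> tr tr' crr'.
have cj : c \in joined T.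
  rewrite inE (inj_eq io_inj).
  case: tr tr' nrr' crr' => -> [] -> nrr' crr'; rewrite ?eqxx // in nrr' *.
    by rewrite nrr'.
  by rewrite eq_sym nrr' adj_connectC.
have ce := connect_edge endsY cj.
by case: tr tr' nrr' => -> [] ->; rewrite ?eqxx // adj_connectC.
Qed.

(** Invariant along a walk of [T]: a recorded terminal [r] is already reached in the glued graph,
    and the current vertex is joined to it inside one piece. The piece can change only at a
    terminal, which then replaces [r]. *)
Lemma reach_terminal T x z : connect (adj ends T) (io x) z ->
  exists2 r, connect (adj endsY (joined T)) x r &
    z = io r \/ exists c, [/\ z \in vert_of ends (seg_edges c), terminal c r &
                             connect (adj ends (T :&: seg_edges c)) (io r) z].
Proof.
elim/connect_ind_right: z /; first by exists x; [exact: connect0|left].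
move=> y z _ [r xr IH] /adjP[e eT yz].
have [yS zS] : y \in vert_of ends (seg_edges (seg e)) /\
               z \in vert_of ends (seg_edges (seg e)).
  by apply: (edge_vert (e := e)); rewrite ?inE.
have cyz : connect (adj ends (T :&: seg_edges (seg e))) y z.
  by apply: connect1; apply/adjP; exists e => //; rewrite !inE eT eqxx.
case: IH => [yr|[c [yc tr ry]]].
  exists r => //; right; exists (seg e); split => //; rewrite -?yr //.
  by apply: seg_terminal; rewrite -yr.
have [ec|nc] := eqVneq c (seg e).
  exists r => //; right; exists c; split => //; rewrite ec //.
  by apply: connect_trans cyz; rewrite -ec.
have [w yw] := seg_meet nc yc yS; subst y.
exists w.
  apply: connect_trans xr (terminal_joined tr _ ry).
  exact: seg_terminal.
by right; exists (seg e); split => //; apply: seg_terminal.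
Qed.

Lemma connect_joined T x y : connect (adj ends T) (io x) (io y) ->
  connect (adj endsY (joined T)) x y.
Proof.
case/reach_terminal=> r xr [/io_inj-> //|[c [yS tr ry]]].
by apply: connect_trans xr (terminal_joined tr _ ry); apply: seg_terminal.
Qed.

(** Each edge of [D] is realised by a path inside its own piece. Recording that only pieces of [D]
    occur allows a given piece to be excluded when cycles are studied. *)
Lemma joined_connect T (D : {set C}) x y : D \subset joined T ->
  connect (adj endsY D) x y ->
  connect (adj ends [set e in T | seg e \in D]) (io x) (io y).
Proof.
move=> sD; elim/connect_ind_right: y /; first exact: connect0.
move=> y z _ xy /adjP[c cD yz]; apply: connect_trans xy _.
have := subsetP sD _ cD; rewrite inE => /andP[_].
have s : T :&: seg_edges c \subset [set e in T | seg e \in D].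
  by apply/subsetP => e; rewrite !inE => /andP[-> /eqP->].
by case: yz => -> /= /(connect_adjS s) //; rewrite adj_connectC.
Qed.

Lemma connect_in_segment T c x y :
  x \in vert_of ends (seg_edges c) -> y \in vert_of ends (seg_edges c) ->
  connect (adj ends T) x y ->
  connect (adj ends (T :&: seg_edges c)) x y \/
  exists r r', [/\ terminal c r, terminal c r' & r != r'] /\
    [/\ connect (adj ends (T :&: seg_edges c)) x (io r),
        connect (adj endsY (joined T)) r r' &
        connect (adj ends (T :&: seg_edges c)) (io r') y].
Proof.
move=> xS yS cxy.
(* Induction on the walk finds the terminal at which it first leaves [c]. *)
have : y \in vert_of ends (seg_edges c) /\
         connect (adj ends (T :&: seg_edges c)) x y \/
       exists r, [/\ terminal c r,
                  connect (adj ends (T :&: seg_edges c)) x (io r) &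
                  connect (adj ends T) (io r) y].
  move: {yS} y cxy; apply: connect_ind_right; first by left; rewrite connect0.
  move=> y z _ IH yz; have cyz := connect1 yz.
  case: IH => [[yS xy]|[r [tr xr ry]]]; last first.
    by right; exists r; split => //; apply: connect_trans cyz.
  case/adjP: yz => e eT yz.
  have [yS' zS'] : y \in vert_of ends (seg_edges (seg e)) /\
                 z \in vert_of ends (seg_edges (seg e)).
    by apply: (edge_vert (e := e)); rewrite ?inE.
  have [ec|nc] := eqVneq c (seg e).
    left; rewrite ec; split => //; rewrite -ec.
    apply: connect_trans xy _; apply: connect1; apply/adjP; exists e => //.
    by rewrite !inE eT ec eqxx.
  have [w yw] := seg_meet nc yS yS'; subst y.
  by right; exists w; split => //; apply: seg_terminal.
case=> [[_ ?]|[r [tr xr ry]]]; first by left.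
suff [r' tr' [rr' ry']] : exists2 r', terminal c r' &
    connect (adj endsY (joined T)) r r' /\
    connect (adj ends (T :&: seg_edges c)) (io r') y.
  have [err'|nrr'] := eqVneq r r'; last by right; exists r, r'.
  by left; apply: connect_trans ry'; rewrite -err'.
case/reach_terminal: ry => r' rr' [yr'|[c' [yS' tr' ry']]].
  by exists r'; [apply: seg_terminal|]; rewrite -?yr' ?connect0.
have [<-|nc] := eqVneq c' c; first by exists r'.
have [w yw] := seg_meet nc yS' yS; subst y.
exists w; first exact: seg_terminal.
rewrite connect0; split => //; apply: connect_trans rr' _.
by apply: terminal_joined tr' _ ry'; apply: seg_terminal.
Qed.

Lemma acyclic_glue T :
  acyclic ends T <->
  acyclic endsY (joined T) /\ forall c, acyclic ends (T :&: seg_edges c).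
Proof.
split=> [acT|[acY acS]].
  split=> [|c]; last by apply: acyclicS acT; apply: subsetIl.
  apply/forall_inP => c; rewrite inE => /andP[nuv cuv].
  (* A cycle of the glued graph through [c] yields a path of [T] between the terminals of [c] that
     uses other pieces only, besides the path inside [c]. *)
  apply/negP => /joined_connect -/(_ T (subsetDl _ _)) cuv'.
  case/eqP: nuv; apply: (acyclic_disjoint_connect acT _ _ _ cuv cuv').
  - exact: subsetIl.
  - by apply/subsetP => e; rewrite inE => /andP[].
  - apply/pred0P => e; rewrite /= !inE.
    by case: (seg e == c); rewrite ?andbF.
apply/forall_inP => e eT; apply/negP => ce.
pose c := seg e; pose T' := T :\ e.
have eS : e \in seg_edges c by rewrite inE.
have eTS : e \in T :&: seg_edges c by rewrite inE eT.
have [xS yS] : (ends e).1 \in vert_of ends (seg_edges c) /\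
               (ends e).2 \in vert_of ends (seg_edges c).
  by apply: (edge_vert eS); left; case: (ends e).
have nloc : ~~ connect (adj ends (T' :&: seg_edges c)) (ends e).1 (ends e).2.
  by rewrite setIDAC; move/forall_inP: (acS c) => /(_ _ eTS).
have sT : T' :&: seg_edges c \subset T :&: seg_edges c.
  by apply: setSI; apply: subsetDl.
case/(connect_in_segment xS yS): ce => [/(negP nloc)//|].
case=> r [r' [[tr tr' nrr'] [xr rr' ry]]].
(* Inside [c] the terminals [r] and [r'] are joined by [T] but not by [T']. Hence [c] lies in
   [joined T] but not in [joined T'], and the path from [r] to [r'] in [joined T'] closes a cycle
   through [c]. *)
have crr' : connect (adj ends (T :&: seg_edges c)) (io r) (io r').
  rewrite adj_connectC in xr; rewrite adj_connectC in ry.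
  apply: connect_trans (connect_adjS sT xr) _.
  by apply: connect_trans (connect_edge ends eTS) _; apply: connect_adjS ry.
have uvrr' F : connect (adj ends F) (io (endsY c).1) (io (endsY c).2) =
               connect (adj ends F) (io r) (io r').
  by case: tr tr' nrr' => -> [] ->; rewrite ?eqxx // adj_connectC.
have niuv : io (endsY c).1 != io (endsY c).2.
  rewrite (inj_eq io_inj).
  by case: tr tr' nrr' => -> [] ->; rewrite ?eqxx // eq_sym.
have cJ : c \in joined T by rewrite inE uvrr' crr' niuv.
have cJ' : c \notin joined T'.
  rewrite inE niuv uvrr'; apply: contra nloc => rr2.
  exact: connect_trans xr (connect_trans rr2 ry).
have sJ : joined T' \subset joined T :\ c.
  apply/subsetP => d dJ; rewrite in_setD1; apply/andP; split.
    by apply: contraNneq cJ' => <-.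
  move: dJ; rewrite !inE => /andP[-> /=]; apply: connect_adjS.
  by apply: setSI; apply: subsetDl.
move/forall_inP: acY => /(_ _ cJ)/negP; apply.
have {}rr' := connect_adjS sJ rr'.
by case: tr tr' nrr' rr' => -> [] ->; rewrite ?eqxx // adj_connectC.
Qed.

Hypothesis covered : forall v, (exists w, v = io w) \/
  exists c, v \in vert_of ends (seg_edges c).
Variable w0 : W.

(** If [T] is connected, a vertex of a piece is joined inside it to the terminal through which it is
    reached from [w0]. Conversely every vertex reaches a terminal, and the terminals are connected
    through the glued graph. *)
Lemma spanning_tree_glue T : spanning_tree ends T =
  spanning_tree endsY (joined T) &&
  [forall c, local_forest ends (seg_edges c) (io (endsY c).1) (io (endsY c).2)
               (c \in joined T) (T :&: seg_edges c)].
Proof.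
apply/spanning_treeP/andP => [[/acyclic_glue[acY acS] cT]|].
  split; first by apply/spanning_treeP; split=> // x y; apply: connect_joined.
  apply/forallP => c; apply/and4P; split => //; first exact: subsetIr.
    apply/forall_inP => x xS.
    suff [r [] -> xr] : exists2 r, terminal c r &
      connect (adj ends (T :&: seg_edges c)) x (io r) by rewrite xr ?orbT.
    have [r _ [xr|[c' [xS' tr rx]]]] := reach_terminal (cT (io w0) x).
      by exists r; [apply: seg_terminal; rewrite -xr|rewrite xr connect0].
    have [cc|nc] := eqVneq c' c; first by exists r; rewrite -?cc // adj_connectC.
    have [w xw] := seg_meet nc xS' xS; subst x.
    by exists w; [apply: seg_terminal|rewrite connect0].
  by rewrite inE eqxx.
case=> /spanning_treeP[acY cY] /forallP loc.
have cW x y : connect (adj ends T) (io x) (io y).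
  apply: connect_adjS (joined_connect (subxx _) (cY x y)).
  by apply/subsetP => e; rewrite inE => /andP[].
have cV x : exists w, connect (adj ends T) (io w) x.
  have [[w ->]|[c xS]] := covered x; first by exists w; rewrite connect0.
  case/and4P: (loc c) => _ _ /forall_inP /(_ _ xS) /orP[] cx _;
    move/(connect_adjS (subsetIl T (seg_edges c))): cx => cx;
    by eexists; rewrite adj_connectC; exact: cx.
split; first by apply/acyclic_glue; split => // c; case/and4P: (loc c).
move=> x y; have [w wx] := cV x; have [w' w'y] := cV y.
by rewrite adj_connectC in wx; apply: connect_trans wx (connect_trans (cW w w') _).
Qed.

(** Once [B = joined T] is fixed, the parts of [T] in the pieces are chosen independently, so the
    sum is a product distributed over sums. General weights serve both plain counting and bundles of
    parallel edges. *)
Lemma sum_spanning_tree_glue (wt : C -> {set E} -> nat) :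
  \sum_(T | spanning_tree ends T) \prod_c wt c (T :&: seg_edges c) =
  \sum_(B | spanning_tree endsY B)
     \prod_c \sum_(F | local_forest ends (seg_edges c)
               (io (endsY c).1) (io (endsY c).2) (c \in B) F) wt c F.
Proof.
rewrite (partition_big joined (spanning_tree endsY)); last first.
  by move=> T; rewrite spanning_tree_glue => /andP[].
apply: eq_bigr => B stB; rewrite bigA_distr_big_dep.
(* [h] glues a family of local forests and [h'] cuts a set of edges into its parts; they are
   mutually inverse on the families that occur. *)
pose h (f : {ffun C -> {set E}}) := \bigcup_c f c.
pose h' (T : {set E}) := [ffun c => T :&: seg_edges c].
rewrite (reindex_onto h h') => [|T _]; last first.
  apply/setP => e; apply/bigcupP/idP => [[c _]|eT]; first by rewrite ffunE inE => /andP[].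
  by exists (seg e); rewrite // ffunE !inE eT eqxx.
have hI f : h' (h f) = f -> forall c, h f :&: seg_edges c = f c.
  by move=> hf c; rewrite -{2}hf ffunE.
apply: eq_big => [f|f /andP[_ /eqP hf]]; last first.
  by apply: eq_bigr => c _; rewrite (hI f hf).
apply/andP/familyP => [[/andP[stT /eqP jB] /eqP hf] c|floc].
  move: stT; rewrite spanning_tree_glue => /andP[_ /forallP/(_ c)].
  by rewrite jB (hI f hf).
have hf : h' (h f) = f.
  apply/ffunP => c; rewrite ffunE; apply/setP => e; rewrite in_setI.
  apply/andP/idP => [[/bigcupP[c' _ ec'] ec]|ec].
    have /and4P[/subsetP/(_ _ ec')] := floc c'.
    by move: ec; rewrite !inE => /eqP <- /eqP e' _ _ _; rewrite e'.
  split; first by apply/bigcupP; exists c.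
  by have /and4P[/subsetP/(_ _ ec)] := floc c.
split; last exact/eqP.
have jB : joined (h f) = B.
  apply/setP => c; rewrite inE (hI f hf).
  by have /and4P[_ _ _ /eqP] := floc c.
rewrite jB eqxx andbT spanning_tree_glue jB stB /=.
by apply/forallP => c; rewrite (hI f hf); exact: floc.
Qed.

End Gluing.

(** * Replacing each edge by a bundle of parallel edges *)

Section Parallel.
Variables (V E W C : finType) (ends : E -> V * V) (endsY : C -> W * W).
Variables (io : W -> V) (seg : E -> C) (w0 : W).
Hypothesis io_inj : injective io.
Hypothesis io_surj : forall v, exists w, v = io w.
Hypothesis ends_parallel : forall e,
  ends e = (io (endsY (seg e)).1, io (endsY (seg e)).2).

Local Notation local c b :=
  (local_forest ends (seg_edges seg c) (io (endsY c).1) (io (endsY c).2) b).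

Lemma parallel_terminal c w :
  io w \in vert_of ends (seg_edges seg c) -> terminal endsY c w.
Proof.
rewrite inE => /existsP[e /andP[]]; rewrite inE /incident ends_parallel => /eqP ->.
by rewrite !(inj_eq io_inj) => /orP[]/eqP <-; [left|right].
Qed.

Lemma parallel_spanned c F :
  [forall x in vert_of ends (seg_edges seg c),
     connect (adj ends F) x (io (endsY c).1) ||
     connect (adj ends F) x (io (endsY c).2)].
Proof.
apply/forall_inP => x; have [w ->] := io_surj x.
by case/parallel_terminal=> ->; rewrite connect0 ?orbT.
Qed.

(** An edge of the bundle would connect the terminals if they are distinct, and would be a loop if
    they coincide. *)
Lemma local_parallel0 c F : local c false F = (F == set0).
Proof.
apply/idP/eqP => [/and4P[/subsetP sF /forall_inP acF _ /eqP nc]|->].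
  apply/setP => e; rewrite inE; apply/negP => eF.
  have := sF e eF; rewrite inE => /eqP ec.
  have := connect_edge ends eF; have := acF e eF.
  rewrite ends_parallel ec /= in nc * => ac ce; move: nc; rewrite ce andbT.
  by move=> /negbFE/eqP euv; rewrite euv connect0 in ac.
apply/and4P; split; [exact: sub0set| |exact: parallel_spanned|].
  by apply/forall_inP => e; rewrite inE.
apply/eqP/negP => /andP[nuv /connect_adj0 euv].
by rewrite euv eqxx in nuv.
Qed.

(** Joining distinct terminals takes at least one edge, and two parallel edges form a cycle. *)
Lemma local_parallel1 c F : (endsY c).1 != (endsY c).2 ->
  local c true F = [exists e in seg_edges seg c, F == [set e]].
Proof.
move=> nuv; apply/idP/exists_inP.
  case/and4P=> /subsetP sF /forall_inP acF _ /eqP/andP[_ cuv].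
  have [F0|[e eF]] := set_0Vmem F.
    by move: cuv; rewrite F0 => /connect_adj0/io_inj euv; rewrite euv eqxx in nuv.
  exists e; first exact: sF.
  rewrite eqEsubset sub1set eF andbT; apply/subsetP => f fF; rewrite inE.
  apply/negPn/negP => nfe; case/negP: (acF _ eF).
  have := sF e eF; have := sF f fF; rewrite !inE => /eqP fc /eqP ec.
  have -> : ends e = ends f by rewrite !ends_parallel fc ec.
  by apply: connect_edge; rewrite !inE nfe.
case=> e eS /eqP ->; have ec : seg e = c by move: eS; rewrite inE => /eqP.
apply/and4P; split; [by rewrite sub1set| |exact: parallel_spanned|].
  apply/forall_inP => f /set1P ->; rewrite setDv; apply/negP => /connect_adj0.
  by rewrite ends_parallel ec /= => /io_inj euv; rewrite euv eqxx in nuv.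
rewrite (inj_eq io_inj) nuv /=.
by have := connect_edge ends (set11 e); rewrite ends_parallel ec => ->.
Qed.

(** Gluing with the bundles as pieces: a bundle in [B] contributes a choice of one edge of weight
    [a] and a weight [b] for each remaining edge, a bundle outside [B] only weights [b]. *)
Lemma sum_spanning_tree_parallel (a b : C -> nat) :
  \sum_(A | spanning_tree ends A)
     \prod_e (if e \in A then a (seg e) else b (seg e)) =
  \sum_(B | spanning_tree endsY B)
     \prod_c (if c \in B
              then #|seg_edges seg c| * (a c * b c ^ #|seg_edges seg c|.-1)
              else b c ^ #|seg_edges seg c|).
Proof.
pose wt c (F : {set E}) := \prod_(e in seg_edges seg c) (if e \in F then a c else b c).
transitivity (\sum_(A | spanning_tree ends A)
                 \prod_c wt c (A :&: seg_edges seg c)).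
  apply: eq_bigr => A _; rewrite (partition_big seg predT) //=.
  apply: eq_bigr => c _; apply: eq_big => [e|e /eqP ec]; first by rewrite inE.
  by rewrite !inE ec eqxx andbT.
rewrite (sum_spanning_tree_glue (endsY := endsY) io_inj _ parallel_terminal _ w0);
  [|by move=> c c' v _ _ _; apply: io_surj|by move=> v; left; apply: io_surj].
apply: eq_bigr => B /spanning_treeP[/forall_inP acB _]; apply: eq_bigr => c _.
have wtE F : F = set0 -> wt c F = b c ^ #|seg_edges seg c|.
  move=> ->; rewrite -prod_nat_const; apply: eq_bigr => e _.
  by rewrite inE.
case: ifPn => cB; last first.
  rewrite (eq_bigl (xpred1 set0)) => [|F]; last exact: local_parallel0.
  by rewrite big_pred1_eq wtE.
(* An edge of a tree is not a loop. *)
have nuv : (endsY c).1 != (endsY c).2.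
  by apply: contra (acB _ cB) => /eqP ->; rewrite connect0.
rewrite (eq_bigl (mem [set [set e] | e in seg_edges seg c])); last first.
  move=> F; rewrite local_parallel1 //=.
  by apply/exists_inP/imsetP => -[e eS]; [move/eqP|]; move=> ->; exists e.
rewrite big_imset /=; last by move=> e f _ _; apply: set1_inj.
rewrite -sum_nat_const; apply: eq_bigr => e eS.
rewrite /wt (bigD1 e) //= set11; congr (_ * _).
rewrite (cardsD1 e) eS /= -prod_nat_const; apply: eq_big => [f|f /andP[_ nfe]].
  by rewrite in_setD1 andbC.
by rewrite inE (negbTE nfe).
Qed.

End Parallel.

(** * Invariance of local forests under embeddings of graphs *)

Section Embedding.
Variables (V E V' E' : finType) (ends : E -> V * V) (ends' : E' -> V' * V').
Variables (f : V -> V') (h : E -> E').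
Implicit Types (F S : {set E}).
Hypotheses (f_inj : injective f) (h_inj : injective h).
Hypothesis ends_h : forall e, ends' (h e) = (f (ends e).1, f (ends e).2).

Lemma connect_embed F x y :
  connect (adj ends' (h @: F)) (f x) (f y) = connect (adj ends F) x y.
Proof.
apply/idP/idP => [cxy|].
  (* Image edges never leave the image of [f], so a walk starting at [f x] can be pulled back step
     by step. *)
  suff [y' /f_inj -> //] : exists2 y', f y = f y' & connect (adj ends F) x y'.
  move: (f y) cxy; apply: connect_ind_right; first by exists x; rewrite ?connect0.
  move=> _ z' _ [y' -> xy] /adjP[_ /imsetP[e eF ->]]; rewrite ends_h.
  have cee := connect_edge ends eF.
  case=> -[]; [move=> /f_inj e1 <-|move=> <- /f_inj e2].
    by exists (ends e).2 => //; apply: connect_trans xy _; rewrite -e1.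
  by exists (ends e).1 => //; apply: connect_trans xy _; rewrite -e2 adj_connectC.
elim/connect_ind_right: y /; first exact: connect0.
move=> y z _ xy /adjP[e eF yz]; apply: connect_trans xy _; apply: connect1.
apply/adjP; exists (h e); first exact: imset_f.
by rewrite ends_h; case: yz => -> /=; [left|right].
Qed.

Lemma acyclic_embed F : acyclic ends' (h @: F) = acyclic ends F.
Proof.
have imD e : h @: F :\ h e = h @: (F :\ e).
  apply/setP => x; rewrite in_setD1; apply/andP/imsetP => [[ne /imsetP[e' eF xe]]|].
    by exists e' => //; rewrite in_setD1 eF andbT; apply: contraNneq ne; rewrite xe => ->.
  by case=> e'; rewrite in_setD1 => /andP[ne eF] ->; rewrite (inj_eq h_inj) imset_f.
apply/forall_inP/forall_inP => acF => [e eF|_ /imsetP[e eF ->]].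
  have := acF _ (imset_f h eF).
  by rewrite imD ends_h connect_embed.
by rewrite imD ends_h connect_embed; apply: acF.
Qed.

Lemma vert_embed S : vert_of ends' (h @: S) = f @: vert_of ends S.
Proof.
apply/setP => x; rewrite inE; apply/existsP/imsetP.
  case=> _ /andP[/imsetP[e eS ->]]; rewrite /incident ends_h /= => /orP[]/eqP <-.
    by exists (ends e).1; rewrite // inE; apply/existsP; exists e; rewrite eS /incident eqxx.
  by exists (ends e).2; rewrite // inE; apply/existsP; exists e;
    rewrite eS /incident eqxx orbT.
case=> y; rewrite inE => /existsP[e /andP[eS ey]] ->; exists (h e).
rewrite imset_f //= /incident ends_h /=.
by case/orP: ey => /eqP ->; rewrite eqxx ?orbT.
Qed.

Lemma card_local_embed S u v b :
  #|[set F | local_forest ends' (h @: S) (f u) (f v) b F]| =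
  #|[set F | local_forest ends S u v b F]|.
Proof.
have him : injective (fun F : {set E} => h @: F) by exact: imset_inj.
rewrite -(card_imset _ him); apply: eq_card => F'.
have loc F : local_forest ends' (h @: S) (f u) (f v) b (h @: F) =
             local_forest ends S u v b F.
  rewrite /local_forest acyclic_embed connect_embed (inj_eq f_inj) vert_embed.
  congr [&& _, _, _ & _].
    apply/subsetP/subsetP => sFS e; last by case/imsetP=> x /sFS xS ->; apply: imset_f.
    by move=> /(imset_f h)/sFS; rewrite mem_imset.
  apply/forall_inP/forall_inP => cF x xS.
    by have := cF _ (imset_f f xS); rewrite !connect_embed.
  by case/imsetP: xS => {}x xS ->; rewrite !connect_embed; apply: cF.
rewrite inE; apply/idP/imsetP => [lF|[F]]; last by rewrite inE -loc => ? ->.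
have eF : F' = h @: (h @^-1: F').
  apply/setP => x; apply/idP/imsetP => [xF|[e]]; last by rewrite inE => ? ->.
  have /and4P[/subsetP/(_ _ xF)/imsetP[e eS xe] _ _ _] := lF.
  by exists e; rewrite // inE -xe.
by exists (h @^-1: F') => //; rewrite inE -loc -eF.
Qed.

End Embedding.

(** * Segments *)

Section Segments.
Variables (V E : finType) (ends : E -> V * V) (ram : pred V).
Implicit Types (d : E * bool) (w : seq (E * bool)).

(** Only the vertex entered has to be unramified, so that a walk may start at a ramified vertex, as
    the initial part of an admissible path does. *)
Definition unram_step : rel V := fun x y => adj ends setT x y && ~~ ram y.

(** The part of [admissible] that is free of the start [u] and can be unfolded recursively along
    [w]. *)
Definition adm_tail v d w : bool :=
  [&& path (fun a b => dtgt ends a == dsrc ends b) d w,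
      dtgt ends (last d w) == v &
      all (fun a => ~~ ram (dtgt ends a)) (belast d w)].

Lemma admissibleE u v w : admissible ends ram u v w =
  if w is d :: w' then [&& ram u, ram v, dsrc ends d == u & adm_tail v d w']
  else false.
Proof. by []. Qed.

Lemma adm_tail_cons v d d' w : adm_tail v d (d' :: w) =
  [&& dtgt ends d == dsrc ends d', ~~ ram (dtgt ends d) & adm_tail v d' w].
Proof. by rewrite /adm_tail /= -!andbA; do !bool_congr. Qed.

Lemma adj_dart d : adj ends setT (dsrc ends d) (dtgt ends d).
Proof.
apply/adjP; exists d.1 => //; rewrite /dsrc /dtgt.
by case: (ends d.1) => x y; case: d.2; [right|left].
Qed.

Lemma dart_of_adj x y : adj ends setT x y ->
  exists d, dsrc ends d = x /\ dtgt ends d = y.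
Proof.
by case/adjP=> e _ [] ee; [exists (e, false)|exists (e, true)];
  rewrite /dsrc /dtgt /= ee.
Qed.

Lemma unram_reach_ram u x : connect unram_step u x -> ram x -> x = u.
Proof.
elim/connect_ind_right: x / => // y z _ _ /andP[_ /negP nz] rz.
by case: nz.
Qed.

Lemma adm_tail_reach v d w d' : adm_tail v d w -> d' \in d :: w ->
  connect unram_step v (dtgt ends d').
Proof.
elim: w d d' => [|d1 w IHw] d d'.
  by rewrite /adm_tail /= andbT inE => /eqP <- /eqP ->; apply: connect0.
rewrite adm_tail_cons => /and3P[/eqP dd nd at1].
rewrite inE => /orP[/eqP ->|]; last exact: IHw.
apply: connect_trans (IHw d1 d1 at1 (mem_head _ _)) _; apply: connect1.
by rewrite /unram_step nd andbT adj_sym dd adj_dart.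
Qed.

Lemma adm_head_reach u v d w d' : connect unram_step u (dsrc ends d) ->
  adm_tail v d w -> d' \in d :: w -> connect unram_step u (dsrc ends d').
Proof.
elim: w d => [|d1 w IHw] d ud; first by rewrite inE => _ /eqP ->.
rewrite adm_tail_cons => /and3P[/eqP dd nd at1].
rewrite inE => /orP[/eqP -> //|]; apply: IHw => //.
apply: connect_trans ud _; rewrite -dd; apply: connect1.
by rewrite /unram_step nd adj_dart.
Qed.

(** The path up to [f], and the path after [f] read backwards from [v], enter unramified vertices
    only. Together with [reach_admissible] this expresses lying on an admissible path by two
    reachability conditions. *)
Lemma admissible_reach u v w f : admissible ends ram u v w -> f \in map fst w ->
  exists d, [/\ d.1 = f, connect unram_step u (dsrc ends d) &
                         connect unram_step v (dtgt ends d)].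
Proof.
case: w => // d0 w; rewrite admissibleE => /and4P[ru rv /eqP su tw].
case/mapP=> d dw ->; exists d; split => //.
  by apply: adm_head_reach tw dw; rewrite su connect0.
exact: adm_tail_reach tw dw.
Qed.

Lemma reach_adm_tail v y : connect unram_step v y ->
  exists w, forall d, dtgt ends d = y -> adm_tail v d w.
Proof.
elim/connect_ind_right: y /.
  by exists [::] => d dv; rewrite /adm_tail /= dv eqxx.
move=> y z _ [w tw] /andP[yz nz].
have [d1 [s1 t1]] : exists d, dsrc ends d = z /\ dtgt ends d = y.
  by apply: dart_of_adj; rewrite adj_sym.
exists (d1 :: w) => d dz.
by rewrite adm_tail_cons dz s1 eqxx nz tw.
Qed.

Lemma reach_adm_head u v x : ram u -> ram v -> connect unram_step u x ->
  forall d w, dsrc ends d = x -> adm_tail v d w ->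
  exists2 w', admissible ends ram u v w' & d \in w'.
Proof.
move=> ru rv ux d w dx tw.
(* The walk is prolonged backwards towards [u], so the induction has to keep all darts of [d :: w]
   and not just the first. *)
suff [w' aw /(_ _ (mem_head _ _))] : exists2 w', admissible ends ram u v w' &
    {subset d :: w <= w'} by exists w'.
move: x ux d w dx tw; apply: connect_ind_right => [|x y _ IH /andP[xy ny]] d w dy tw.
  by exists (d :: w) => //; rewrite admissibleE ru rv dy eqxx.
have [d1 [s1 t1]] := dart_of_adj xy.
case: (IH d1 (d :: w) s1); first by rewrite adm_tail_cons t1 dy eqxx ny.
by move=> w' aw sw; exists w' => // e ew; apply: sw; rewrite inE ew orbT.
Qed.

Lemma reach_admissible u v d : ram u -> ram v ->
  connect unram_step u (dsrc ends d) -> connect unram_step v (dtgt ends d) ->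
  exists2 w, admissible ends ram u v w & d.1 \in map fst w.
Proof.
move=> ru rv us /reach_adm_tail[w tw].
have [w' aw dw] := reach_adm_head ru rv us erefl (tw d erefl).
by exists w' => //; apply: map_f.
Qed.

(* Following one of the paths up to the common edge and the other one after
   it, possibly backwards. *)
Lemma admissible_splice u v w w' f : admissible ends ram u u w ->
  admissible ends ram v v w' -> f \in map fst w -> f \in map fst w' ->
  exists2 w2, admissible ends ram u v w2 & f \in map fst w2.
Proof.
move=> aw aw' fw fw'.
have ru : ram u by case: w aw {fw} => // d w; rewrite admissibleE => /and4P[].
have rv : ram v by case: w' aw' {fw'} => // d w'; rewrite admissibleE => /and4P[].
have [[f1 b] /= [f1f us ut]] := admissible_reach aw fw.
have [[f2 b'] /= [f2f us' ut']] := admissible_reach aw' fw'.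
subst f1 f2; apply: (@reach_admissible u v (f, b)) => //.
by move: us' ut'; rewrite /dsrc /dtgt /=; case: b b' {us ut} => -[].
Qed.

Lemma admissible_ends_vert (S : {set E}) u v w : admissible ends ram u v w ->
  {subset map fst w <= S} ->
  [/\ ram u, ram v, u \in vert_of ends S & v \in vert_of ends S].
Proof.
case: w => // d w; rewrite admissibleE => /and4P[ru rv /eqP du /and3P[_ /eqP dv _]] sw.
have h d' : d' \in d :: w ->
    dsrc ends d' \in vert_of ends S /\ dtgt ends d' \in vert_of ends S.
  move=> d'w; apply: (edge_vert (e := d'.1)); first by apply: sw; apply: map_f.
  by rewrite /dsrc /dtgt; case: (ends d'.1) => x y; case: d'.2; [right|left].
split=> //; first by rewrite -du; case: (h d (mem_head _ _)).
by rewrite -dv; case: (h _ (mem_last d w)).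
Qed.

(** Both endpoints of [f] are reached from [u] or [v] through unramified vertices, and a ramified
    vertex is reached in this way only by the empty walk. *)
Lemma admissible_ram_vert u v w f r : admissible ends ram u v w ->
  f \in map fst w -> incident ends f r -> ram r -> r = u \/ r = v.
Proof.
move=> aw fw fr rr; have [[f1 b] /= [ef us vt]] := admissible_reach aw fw.
have [rs|rt] : r = dsrc ends (f1, b) \/ r = dtgt ends (f1, b).
- move: fr; rewrite /incident -ef /dsrc /dtgt /=.
  by case: b {us vt} => /orP[]/eqP <-; auto.
- by left; apply: unram_reach_ram => //; rewrite rs.
- by right; apply: unram_reach_ram => //; rewrite rt.
Qed.

Lemma same_group_on_some (P : seq (E * bool) -> Prop) e f :
  on_some P e -> same_group P e f -> on_some P f.
Proof.
move=> oe sg; elim: sg oe => // [x y [w [Pw xw yw]] _|x y z _ IH1 _ IH2 /IH1/IH2//].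
by exists w.
Qed.

Lemma same_group_path (P : seq (E * bool) -> Prop) w e :
  P w -> e \in map fst w -> forall f, f \in map fst w -> same_group P e f.
Proof. by move=> Pw ew f fw; apply: rt_step; exists w. Qed.

(** For a 2-segment, [u] and [v] are the pair common to its group; for a 1-segment, [u = v] is the
    base common to its closed paths. *)
Lemma segment_terminals k' k (S : 'I_k -> {set E}) i :
  segment_decomposition ends ram k' S ->
  exists u v, [/\ ram u, ram v, u \in vert_of ends (S i), v \in vert_of ends (S i) &
    forall r, r \in vert_of ends (S i) -> ram r -> r = u \/ r = v].
Proof.
case=> _ [pair [seg2 [cov2 [_ [seg1 _]]]]].
have [ik|ik] := ltnP i k'.
  have [e [oe Si]] := seg2 i ik.
  have [w [Pw ew]] := oe; have [u [v [nuv aw]]] := Pw.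
  have sw : {subset map fst w <= S i}.
    by move=> f fw; apply/Si; apply: (same_group_path Pw).
  have [ru rv uS vS] := admissible_ends_vert aw sw.
  exists u, v; split => // r; rewrite inE => /existsP[f /andP[fS fr]] rr.
  have ef := proj1 (Si f) fS.
  have [w' [[u' [v' [nuv' aw']]] fw']] := same_group_on_some oe ef.
  have := admissible_ram_vert aw' fw' fr rr.
  have : (u = u' /\ v = v') \/ (u = v' /\ v = u').
    by apply: (pair w w') => //; exists e, f.
  by case=> -[-> ->] []; auto.
have [e [oe Si]] := seg1 i ik.
have [w [Pw ew]] := oe; have [u [aw nD]] := Pw.
have sw : {subset map fst w <= S i}.
  by move=> f fw; apply/Si; apply: (same_group_path Pw).
have [ru _ uS _] := admissible_ends_vert aw sw.
exists u, u; split => // r; rewrite inE => /existsP[f /andP[fS fr]] rr.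
(* Closed paths with different bases and a common edge splice to a path between distinct ramified
   vertices. The common edge would then lie in a 2-segment, which [w1] avoids. *)
have base_uniq x w1 u1 w2 u2 : admissible ends ram u1 u1 w1 ->
    admissible ends ram u2 u2 w2 ->
    all (fun d => d.1 \notin \bigcup_(i : 'I_k | i < k') S i) w1 ->
    x \in map fst w1 -> x \in map fst w2 -> u1 = u2.
  move=> a1 a2 nD1 x1 x2; apply/eqP/negPn/negP => nu.
  have [w3 a3 x3] := admissible_splice a1 a2 x1 x2.
  have [|j [jk xj]] := cov2 x; first by exists w3; split => //; exists u1, u2.
  case/mapP: x1 => d dw xd; have /negP := allP nD1 d dw; apply.
  by apply/bigcupP; exists j; rewrite -?xd.
suff [w' [aw' _] fw'] : exists2 w', admissible ends ram u u w' /\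
    all (fun d => d.1 \notin \bigcup_(i : 'I_k | i < k') S i) w' & f \in map fst w'.
  exact: admissible_ram_vert aw' fw' fr rr.
have := proj1 (Si f) fS; have : exists2 w', admissible ends ram u u w' /\
    all (fun d => d.1 \notin \bigcup_(i : 'I_k | i < k') S i) w' & e \in map fst w'.
  by exists w.
(* The base [u] is carried along the chain of links from [e] to [f]. *)
move=> Qe sg; elim: sg Qe => // [x y [w1 [[u1 [a1 n1]] x1 y1]] [w2 [a2 n2] x2]|].
  by exists w1 => //; rewrite -(base_uniq _ _ _ _ _ a1 a2 n1 x1 x2).
by move=> x y z _ IH1 _ IH2 /IH1/IH2.
Qed.

(** Each component in [A] has exactly one ramified vertex, so sending a ramified vertex to the root
    of its component is a bijection. *)
Lemma n_comp_ram F (A : {set V}) :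
  (forall x, x \in A -> #|[set r in A | ram r && connect (adj ends F) x r]| = 1) ->
  closed (adj ends F) (mem A) ->
  n_comp (adj ends F) (mem A) = #|[set r in A | ram r]|.
Proof.
move=> one clA; have sF := sym_connect_sym (@adj_sym _ _ ends F).
rewrite /n_comp_mem -(@card_in_imset _ _ (root (adj ends F))); last first.
  move=> r r'; rewrite !inE => /andP[rA rr] /andP[rA' rr'] /eqP.
  rewrite (root_connect sF) => crr'.
  have /eqP/cards1P[z Ez] := one r rA.
  have : r \in [set z] by rewrite -Ez inE rA rr connect0.
  have : r' \in [set z] by rewrite -Ez inE rA' rr' crr'.
  by move=> /set1P -> /set1P ->.
apply: eq_card => x; rewrite !inE; apply/andP/imsetP => [[rx xA]|[r rA ->]].
  have /eqP/cards1P[z Ez] := one x xA.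
  have : z \in [set z] by rewrite inE.
  rewrite -Ez inE => /and3P[zA rz xz]; exists z; rewrite ?inE ?zA //.
  by rewrite -(rootP sF xz); apply/esym/eqP.
split; first exact: roots_root.
move: rA; rewrite inE => /andP[rA _].
by rewrite -(closed_connect clA (connect_root _ r)).
Qed.

Lemma closed_vert (F S : {set E}) : F \subset S ->
  closed (adj ends F) (mem (vert_of ends S)).
Proof.
move=> /subsetP sFS x y /adjP[e eF xy].
by have [xS yS] := edge_vert (sFS _ eF) xy; rewrite /= !inE in xS yS *; rewrite xS yS.
Qed.

(** The ramified vertices of [S] are [u] and [v], possibly equal. One of them per tree means that
    every vertex reaches a terminal and distinct terminals are separated; the number of trees then
    follows from [n_comp_ram]. *)
Lemma Fnum_local (S : {set E}) u v : ram u -> ram v ->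
  u \in vert_of ends S -> v \in vert_of ends S ->
  (forall r, r \in vert_of ends S -> ram r -> r = u \/ r = v) ->
  Fnum ends ram (nram_in ends ram S) S =
  #|[set F | local_forest ends S u v false F]|.
Proof.
move=> ru rv uS vS ramS; apply: eq_card => F; rewrite !inE /good_forest /local_forest.
have [sFS|//] := boolP (F \subset S); case: (acyclic ends F) => //=.
have rE x : x \in vert_of ends S ->
    [set r in vert_of ends S | ram r && connect (adj ends F) x r] =
    [set r in [set u; v] | connect (adj ends F) x r].
  move=> xS; apply/setP => r; rewrite in_set [RHS]in_set in_set2.
  apply/and3P/andP => [[rS rr xr]|[/orP[]/eqP -> xr]]; split => //.
  by case: (ramS r rS rr) => ->; rewrite eqxx ?orbT.
apply/andP/andP => [[_ /forall_inP one]|[/forall_inP cov /eqP nuv]].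
  split.
    apply/forall_inP => x xS; have /cards1P[z Ez] := one x xS.
    have : z \in [set z] by rewrite inE.
    by rewrite -Ez rE // !inE => /andP[/orP[]/eqP <- ->]; rewrite ?orbT.
  apply/eqP/negP => /andP[nuv cuv].
  have /cards1P[z Ez] := one u uS; rewrite rE // in Ez.
  have : u \in [set z] by rewrite -Ez !inE eqxx connect0.
  have : v \in [set z] by rewrite -Ez !inE eqxx orbT cuv.
  by move=> /set1P zv /set1P zu; rewrite zu zv eqxx in nuv.
have one x : x \in vert_of ends S ->
    #|[set r in vert_of ends S | ram r && connect (adj ends F) x r]| = 1.
  move=> xS; rewrite rE //; apply/eqP/cards1P.
  have sF a b : connect (adj ends F) x a -> connect (adj ends F) x b ->
      connect (adj ends F) a b.
    by rewrite adj_connectC; apply: connect_trans.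
  have [xu|nxu] := boolP (connect (adj ends F) x u).
    exists u; apply/setP => r; rewrite !inE; apply/andP/eqP => [[/orP[]/eqP -> // xv]|->].
      by apply/eqP; move/negbT: nuv; rewrite eq_sym (sF _ _ xu xv) andbT negbK.
    by rewrite eqxx xu.
  have xv : connect (adj ends F) x v by move: (cov x xS); rewrite (negbTE nxu).
  exists v; apply/setP => r; rewrite !inE; apply/andP/eqP => [[/orP[]/eqP -> //]|->].
    by rewrite (negbTE nxu).
  by rewrite eqxx orbT xv.
split; last by apply/forall_inP => x xS; rewrite one.
by apply/eqP; apply: n_comp_ram one _; apply: closed_vert.
Qed.

End Segments.

(** * The tower *)

Section TowerVertices.
Variables (V : finType) (I : V -> option nat) (p : nat).
Hypothesis p_gt0 : 0 < p.

Lemma tvert_eq n (x y : tvert I p n) : tag x = tag y ->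
  tagged x = tagged y :> nat -> x = y.
Proof.
case: x y => v g [v' g'] /= vv; move: g'; rewrite -vv => g' gg.
by congr (existT _ v _); apply: val_inj.
Qed.

Lemma tpt_repr n (x : tvert I p n) : exists g, x = tpt I p n (tag x) g.
Proof.
have le : p ^ lev I (tag x) n <= p ^ n by rewrite leq_pexp2l ?lev_le.
by exists (widen_ord le (tagged x)); apply: tvert_eq => //=; rewrite modn_small.
Qed.

Lemma tpt_inj n v v' g g' : tpt I p n v g = tpt I p n v' g' -> v = v'.
Proof. by move/(congr1 tag). Qed.

Lemma tpt_unram_inj n v g g' : ~~ ramified I v ->
  tpt I p n v g = tpt I p n v g' -> g = g'.
Proof.
rewrite negbK => /eqP Iv /(congr1 (fun x : tvert I p n => tagged x : nat)) /=.
have -> : lev I v n = n by rewrite /lev Iv.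
by rewrite !modn_small // => /val_inj.
Qed.

Section Lift.
Variables (m n : nat).
Hypotheses (le_mn : m <= n) (levE : forall v, lev I v n = lev I v m).

Lemma lev_bound v : p ^ lev I v m <= p ^ n.
Proof. by rewrite leq_pexp2l // (leq_trans (lev_le I v m)). Qed.

(** A coset is represented by its least residue, read modulo [p ^ n]; under [levE] this identifies
    the vertices of the two layers. *)
Definition tlift (x : tvert I p m) : tvert I p n :=
  tpt I p n (tag x) (widen_ord (lev_bound (tag x)) (tagged x)).

Lemma tlift_tpt v (g : 'I_(p ^ n)) :
  tlift (tpt I p m v (proj_mod le_mn g)) = tpt I p n v g.
Proof.
apply: tvert_eq => //=; rewrite levE modn_mod modn_dvdm //.
by rewrite dvdn_exp2l // lev_le.
Qed.

Lemma tlift_inj : injective tlift.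
Proof.
move=> x y exy; have etag : tag x = tag y by have := congr1 tag exy.
apply: tvert_eq => //.
have /= := congr1 (fun x : tvert I p n => tagged x : nat) exy.
by rewrite !levE !modn_small.
Qed.

Lemma tlift_surj y : exists x, y = tlift x.
Proof.
have [g ->] := tpt_repr y.
by exists (tpt I p m (tag y) (proj_mod le_mn g)); rewrite tlift_tpt.
Qed.

Lemma card_proj_mod_fiber (c : 'I_(p ^ m)) :
  #|[set g : 'I_(p ^ n) | proj_mod le_mn g == c]| = p ^ (n - m).
Proof.
(* The fibre over [c] consists of the numbers [c + j * p ^ m] with [j < p ^ (n - m)]. *)
have bnd (j : 'I_(p ^ (n - m))) : c + j * p ^ m < p ^ n.
  have -> : p ^ n = p ^ (n - m) * p ^ m by rewrite -expnD subnK.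
  rewrite -ltn_divLR ?expn_gt0 ?p_gt0 //.
  by rewrite addnC divnMDl ?expn_gt0 ?p_gt0 // divn_small // addn0.
pose f j := Ordinal (bnd j).
have f_inj : injective f.
  move=> i j /(congr1 (@nat_of_ord _)) /= /eqP.
  by rewrite eqn_add2l eqn_pmul2r ?expn_gt0 ?p_gt0 // => /eqP/val_inj.
rewrite -[RHS]card_ord -(card_imset _ f_inj); apply: eq_card => g.
rewrite inE; apply/eqP/imsetP => [gc|[j _ ->]]; last first.
  by apply: val_inj; rewrite /= addnC modnMDl modn_small.
have lt : g %/ p ^ m < p ^ (n - m).
  by rewrite ltn_divLR ?expn_gt0 ?p_gt0 // -expnD subnK.
exists (Ordinal lt) => //; apply: val_inj => /=.
by rewrite -gc /= addnC -divn_eq.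
Qed.

End Lift.
End TowerVertices.

(** * The ramified vertices of the layers *)

Section RamifiedVertices.
Variables (V : finType) (I : V -> option nat) (p : nat).

Definition ram_vert : finType := {v : V | ramified I v}.
(** With the inertia restricted to ramified vertices, the tower construction itself provides the
    vertex set [tvert ram_inertia p n] of [Y_n]. *)
Definition ram_inertia (r : ram_vert) : option nat := I (val r).

Definition ram_incl n (x : tvert ram_inertia p n) : tvert I p n :=
  @Tagged V (val (tag x)) (fun v => 'I_(p ^ lev I v n)) (tagged x).

Lemma ram_incl_inj n : injective (@ram_incl n).
Proof.
move=> x y exy; apply: tvert_eq.
  by apply: val_inj; have := congr1 tag exy.
by have := congr1 (fun x : tvert I p n => tagged x : nat) exy.
Qed.

Lemma ram_incl_tpt n r g :
  ram_incl (tpt ram_inertia p n r g) = tpt I p n (val r) g.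
Proof. exact: tvert_eq. Qed.

Lemma ram_incl_surj n (x : tvert I p n) : ramified I (tag x) ->
  exists y, x = ram_incl y.
Proof.
move=> rx.
exists (@Tagged ram_vert (exist _ (tag x) rx)
         (fun r => 'I_(p ^ lev ram_inertia r n)) (tagged x)).
exact: tvert_eq.
Qed.

Lemma nram_layerE n : nram_layer I p n = #|tvert ram_inertia p n|.
Proof.
rewrite -(card_codom (@ram_incl_inj n)); apply: eq_card => x; rewrite inE.
apply/idP/codomP => [/ram_incl_surj //|[y ->]]; exact: valP.
Qed.

Lemma nram_layer_sum n :
  nram_layer I p n = \sum_(r : ram_vert) p ^ lev ram_inertia r n.
Proof.
rewrite nram_layerE card_tagged sumnE big_map big_enum /=.
by apply: eq_bigr => r _; rewrite card_ord.
Qed.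

(** Every term of [nram_layer_sum] is nondecreasing in the layer, so a constant sum forces constant
    terms; [1 < p] then recovers the exponents. *)
Lemma lev_stable m n : 1 < p -> m <= n -> nram_layer I p n = nram_layer I p m ->
  forall r, lev ram_inertia r n = lev ram_inertia r m.
Proof.
move=> p_gt1 le_mn; rewrite !nram_layer_sum => /esym/eqP.
have le r : p ^ lev ram_inertia r m <= p ^ lev ram_inertia r n.
  rewrite leq_exp2l // /lev; case: (ram_inertia r) => // a.
  by rewrite leq_min geq_minl (leq_trans (geq_minr _ _)).
rewrite (leqif_sum (fun r _ => leqif_geq (le r))) => /forallP h r; apply/eqP.
have := h r; rewrite /= leq_exp2l // => le1.
by rewrite eqn_leq le1 /= -(leq_exp2l _ _ p_gt1).
Qed.

End RamifiedVertices.

(** * Spanning trees of the layers of the tower *)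

Section TowerCount.
Variables (V E K : finType) (ends : E -> V * V) (I : V -> option nat) (p : nat).
Local Notation VR := (ram_vert I).
Variables (seg : E -> K) (endsY : K -> VR * VR) (v0 : V).
Hypothesis p_gt1 : 1 < p.
Hypothesis ram_v0 : ramified I v0.
Hypothesis seg_meet : forall e e' v, incident ends e v -> incident ends e' v ->
  seg e != seg e' -> ramified I v.
Hypothesis seg_term : forall e (r : VR), incident ends e (val r) ->
  r = (endsY (seg e)).1 \/ r = (endsY (seg e)).2.
Hypothesis covered : forall v, ~~ ramified I v -> exists e, incident ends e v.

Local Notation IR := (@ram_inertia V I).

Definition local_count (i : K) (b : bool) : nat :=
  #|[set F | local_forest ends (seg_edges seg i)
               (val (endsY i).1) (val (endsY i).2) b F]|.

Definition tseg n (x : tedge E p n) : tedge K p n := (seg x.1, x.2).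

Let p_gt0 : 0 < p := ltnW p_gt1.

Lemma tower_pt n : exists w : tvert IR p n, True.
Proof.
have lt : 0 < p ^ n by rewrite expn_gt0 p_gt0.
by exists (tpt IR p n (exist _ v0 ram_v0) (Ordinal lt)).
Qed.

Lemma tincident n (x : tedge E p n) y :
  incident (tends ends I p n) x y =
  incident ends x.1 (tag y) && (tpt I p n (tag y) x.2 == y).
Proof.
rewrite /incident /tends /=.
apply/orP/andP => [[]/eqP <- /=|[]]; rewrite ?eqxx ?orbT //.
by case/orP=> /eqP -> /eqP ->; rewrite eqxx; auto.
Qed.

Lemma tvertP n c y :
  reflect (exists2 x : tedge E p n, tseg x = c & incident (tends ends I p n) x y)
          (y \in vert_of (tends ends I p n) (seg_edges (@tseg n) c)).
Proof.
rewrite inE; apply: (iffP existsP) => [[x /andP[]]|[x xc xy]].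
  by rewrite inE => /eqP; exists x.
by exists x; rewrite inE xc eqxx.
Qed.

(** The gluing identity with all weights 1 and the copies [(i, g)] as pieces. Here
    [tends endsY IR p n] is [Y_n], built as a layer over the graph on the ramified vertices with one
    edge per segment. *)
Lemma kappa_tower n : kappa (tends ends I p n) =
  \sum_(A | spanning_tree (tends endsY IR p n) A)
     \prod_(c : tedge K p n) local_count c.1 (c \in A).
Proof.
have [w0 _] := tower_pt n.
rewrite /kappa cardsE -sum1_card.
rewrite (eq_bigr (fun T => \prod_(c : tedge K p n) 1)) => [|T _]; last by rewrite big1.
rewrite (sum_spanning_tree_glue (endsY := tends endsY IR p n)
  (io := @ram_incl V I p n) (seg := @tseg n) (@ram_incl_inj V I p n)
  _ _ _ w0 (fun _ _ => 1)).
- apply: eq_bigr => A _; apply: eq_bigr => -[i g] _; rewrite sum1dep_card /=.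
  rewrite !ram_incl_tpt /local_count.
  (* The copy [(i, g)] is an embedded image of segment [i], so its local counts do not depend on
     [g]. *)
  have -> : seg_edges (@tseg n) (i, g) = [set (e, g) | e in seg_edges seg i].
    apply/setP => -[e g']; rewrite inE; apply/eqP/imsetP => [[ei ->]|].
      by exists e; rewrite // inE ei.
    by case=> e'; rewrite inE => /eqP ei [-> ->]; rewrite /tseg /= ei.
  apply: (card_local_embed (f := fun v => tpt I p n v g)) => //.
    by move=> v v' /tpt_inj.
  by move=> e e' [].
- move=> c c' y nc /tvertP[[e g] ec] + /tvertP[[e' g'] ec'].
  rewrite !tincident /= => /andP[ey /eqP yg] /andP[ey' /eqP yg'].
  apply: ram_incl_surj; have [//|nr] := boolP (ramified I (tag y)).
  (* At an unramified vertex the coset determines [g], so distinct copies meeting there would come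
     from distinct segments, against [seg_meet]. *)
  have eg : g = g' by apply: tpt_unram_inj nr _; rewrite yg yg'.
  case: (negP nr); apply: seg_meet ey ey' _; apply: contraNneq nc => es.
  by rewrite -ec -ec' /tseg /= es eg.
- move=> c w /tvertP[[e g] <-]; rewrite tincident /= => /andP[ey /eqP yg].
  have ww : w = tpt IR p n (tag w) g.
    by apply: ram_incl_inj; rewrite ram_incl_tpt yg.
  by rewrite ww; have [->|->] := seg_term ey; [left|right].
- move=> y; have [ry|nry] := boolP (ramified I (tag y)).
    by left; apply: ram_incl_surj.
  right; have [e ey] := covered nry; have [g yg] := tpt_repr p_gt0 y.
  exists (seg e, g); apply/tvertP; exists (e, g) => //.
  by rewrite tincident ey -yg eqxx.
Qed.

(** Reduction modulo [p ^ m] exhibits [Y_n] as [Y_m] with each edge replaced by [q] parallel ones.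
    Both counts become sums over the spanning trees of [Y_m], compared term by term. *)
Lemma kappa_tower_step m n : m <= n ->
  (forall r, lev IR r n = lev IR r m) ->
  kappa (tends ends I p n) =
    kappa (tends ends I p m) * p ^ ((n - m) * (#|tvert IR p m| - 1)) *
    \prod_i local_count i false ^ (p ^ n - p ^ m).
Proof.
move=> le_mn levE; have [w0 _] := tower_pt m.
pose q := p ^ (n - m).
have q_gt0 : 0 < q by rewrite expn_gt0 p_gt0.
pose pr (x : tedge K p n) : tedge K p m := (x.1, proj_mod le_mn x.2).
have card_pr c : #|seg_edges pr c| = q.
  rewrite /q -(card_proj_mod_fiber p_gt0 le_mn c.2).
  rewrite -[RHS](@card_imset _ _ (fun g => (c.1, g))) => [|g g' []//].
  apply: eq_card => -[i g]; rewrite inE; apply/eqP/imsetP => [<-|].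
    by exists g; rewrite // inE.
  by case=> g'; rewrite inE => /eqP gc [-> ->]; rewrite /pr /= gc; case: (c).
rewrite !kappa_tower.
rewrite (eq_bigr (fun A : {set tedge K p n} => \prod_(x : tedge K p n)
  (if x \in A then local_count (pr x).1 true else local_count (pr x).1 false)));
  last by move=> A _; apply: eq_bigr => x _; case: (x \in A).
rewrite (sum_spanning_tree_parallel (endsY := tends endsY IR p m) w0
  (tlift_inj (p_gt0 := p_gt0) (le_mn := le_mn) levE)
  (tlift_surj p_gt0 le_mn levE) _ (fun c => local_count c.1 true)
  (fun c => local_count c.1 false)); last first.
  by move=> x; rewrite /tends /= !tlift_tpt.
rewrite !big_distrl; apply: eq_bigr => B stB /=.
(* The exponent counts the edges of [B], each giving one factor [q]. *)
rewrite -(card_spanning_tree w0 stB) expnM -/q.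
(* Segment [i] has [p ^ m] copies in [Y_m], and [p ^ m * (q - 1) = p ^ n - p ^ m]. *)
have -> : \prod_i local_count i false ^ (p ^ n - p ^ m) =
          \prod_(c : tedge K p m) local_count c.1 false ^ q.-1.
  rewrite -(pair_bigA _ (fun (i : K) (_ : 'I_(p ^ m)) => local_count i false ^ q.-1)) /=.
  apply: eq_bigr => i _; rewrite prod_nat_const card_ord -expnM; congr (_ ^ _).
  by rewrite -subn1 mulnBl mul1n /q -expnD subnK.
have -> : q ^ #|B| = \prod_(c : tedge K p m) (if c \in B then q else 1).
  by rewrite -big_mkcond prod_nat_const.
rewrite -!big_split; apply: eq_bigr => c _ /=; rewrite card_pr.
case: (c \in B); first by rewrite mulnA [q * _]mulnC.
by rewrite muln1 -expnS prednK.
Qed.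

End TowerCount.

Theorem theorem5p18 (V E : finType) (ends : E -> V * V) (I : V -> option nat)
    (p : nat) (k' k : nat) (S : 'I_k -> {set E}) (n0 : nat) :
  prime p ->
  gconnected ends ->
  (forall n, gconnected (tends ends I p n)) ->
  (forall v, ~~ tail ends (ramified I) v) ->
  (exists v, totally_ramified I v) ->
  segment_decomposition ends (ramified I) k' S ->
  (forall n, n0 <= n -> nram_layer I p n = nram_layer I p n0) ->
  forall n, n0 <= n ->
    kappa (tends ends I p n) =
      kappa (tends ends I p n0) * p ^ ((n - n0) * (nram_layer I p n0 - 1)) *
      \prod_(i < k) Fnum ends (ramified I) (nram_in ends (ramified I) (S i)) (S i)
                       ^ (p ^ n - p ^ n0).
Proof.
move=> p_pr _ _ _ [v0 tr_v0] dec stable n le_n0n.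
have p_gt1 := prime_gt1 p_pr.
have ram_v0 : ramified I v0 by rewrite /ramified tr_v0.
have [_ [_ [_ [_ [_ [_ [_ [disj [unr [cov covV]]]]]]]]]] := dec.
(* The segments cover the edges and are disjoint, so [seg] is determined by them. *)
have [seg segS] := fin_all_exists cov.
have segE e i : e \in S i -> seg e = i.
  move=> eS; apply/eqP/negPn/negP => nei.
  by have := disjointFr (disj _ _ nei) (segS e); rewrite eS.
have seg_edgesE i : seg_edges seg i = S i.
  by apply/setP => e; rewrite inE; apply/eqP/idP => [<-|/segE].
have incS e v : incident ends e v -> v \in vert_of ends (S (seg e)).
  by move=> ev; rewrite inE; apply/existsP; exists e; rewrite segS.
(* Terminals are taken in [ram_vert I], so that the segments become edges of a graph on the ramified
   vertices. *)
have term i : exists t : ram_vert I * ram_vert I,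
    [/\ val t.1 \in vert_of ends (S i), val t.2 \in vert_of ends (S i) &
      forall r, r \in vert_of ends (S i) -> ramified I r ->
        r = val t.1 \/ r = val t.2].
  have [u [v [ru rv uS vS ramS]]] := segment_terminals i dec.
  by exists (exist _ u ru, exist _ v rv).
have [endsY endsYP] := fin_all_exists term.
(* Forests separating the terminals are those counted by [Fnum]; the counts of trees joining them
   remain inside the [kappa] of layer [n0]. *)
have FnumE i : Fnum ends (ramified I) (nram_in ends (ramified I) (S i)) (S i) =
               local_count ends seg endsY i false.
  have [uS vS ramS] := endsYP i.
  rewrite /local_count seg_edgesE.
  by apply: Fnum_local => //; exact: valP.
under eq_bigr do rewrite FnumE.
rewrite nram_layerE.
apply: (kappa_tower_step (v0 := v0)) => //.
- move=> e e' v ev ev' nee'; have [//|nr] := boolP (ramified I v).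
  by case: (unr _ _ _ nee' nr); split; apply: incS.
- move=> e r er; have [_ _ ramS] := endsYP (seg e).
  by case: (ramS _ (incS _ _ er) (valP r)) => /val_inj; auto.
- move=> v _; have [i] := covV v.
  by rewrite inE => /existsP[e /andP[_ ev]]; exists e.
- exact: lev_stable p_gt1 le_n0n (stable n le_n0n).
Qed.
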